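(* Let $f_0,f_1$ satisfy [A1]--[A4] and let the sequences $\{x^k\}_{k\in\mathbb{N}}$, $\{\tilde y^k\}_{k\in\mathbb{N}}$, $\{\hat y^k\}_{k\in\mathbb{N}}\subset\mathbb{R}^n$, $\{U^k\}_{k\in\mathbb{N}}\subset\mathbb{R}$ satisfy [S1]--[S3] (all conditions are listed in the context). Then every limit point $x^*$ of $\{x^k\}_{k\in\mathbb{N}}$ is stationary for the problem $\min_{x\in\mathbb{R}^n}F(x)$, $F=f_0+f_1$ (that is, $x^*\in\mathrm{dom}(F)$ and $0\in\partial F(x^* )$), and $\lim_{k\to\infty}\Phi(x^k,U^k)=F(x^* )$.
   Context: Let $F=f_0+f_1$ on $\mathbb{R}^n$. Assumptions on the functions: [A1] $f_1:\mathbb{R}^n\to\mathbb{R}\cup\{+\infty\}$ is proper, lower semicontinuous and convex. [A2] $f_0:\mathbb{R}^n\to\mathbb{R}$ is continuously differentiable on an open set $\Omega_0\supset\overline{\mathrm{dom}(f_1)}$. [A3] $\nabla f_0$ is $L_{f_0}$-Lipschitz continuous on $\mathrm{dom}(f_1)$. [A4] $F$ is bounded from below. Fixed parameters: $0<\alpha_{\min}\le\alpha_{\max}$, $\delta\in(0,1)$, $\omega\in(0,1)$. The sequences satisfy $x^0\in\mathrm{dom}(f_1)$ and $x^{k+1}=x^k+\eta_k(\tilde y^k-x^k)$ with $\eta_k\in(0,1]$ for all $k\ge 0$. Notation: $\mathrm{prox}_{\alpha f_1}(z)=\arg\min_y\{f_1(y)+\frac{1}{2\alpha}\|y-z\|^2\}$;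 $H_k(y)=\langle\nabla f_0(x^k),y-x^k\rangle+\frac{1}{2\alpha_k}\|y-x^k\|^2+f_1(y)-f_1(x^k)$; $\tilde\Delta_k=\langle\nabla f_0(x^k),\tilde y^k-x^k\rangle+\frac{1}{2\alpha_k}\|\tilde y^k-x^k\|^2+f_1(\tilde y^k)-U^k$; $\Phi(x,U)=f_0(x)+U$ for $(x,U)\in\mathbb{R}^n\times\mathbb{R}$; $d^k=\tilde y^k-x^k$. Conditions on the sequences: [S1] $U^0=f_1(x^0)$ and $U^{k+1}=\eta_kf_1(\tilde y^k)+(1-\eta_k)U^k$ for $k\ge0$. [S2] $\alpha_k\in[\alpha_{\min},\alpha_{\max}]$, $\hat y^k=\mathrm{prox}_{\alpha_kf_1}(x^k-\alpha_k\nabla f_0(x^k))$, and there is $\mu>0$ such that $H_k(\tilde y^k)-H_k(\hat y^k)\le-\frac{\mu}{2}\tilde\Delta_k$ for all $k$. [S3] For each $k$, $m_k$ is the smallest non-negative integer $m$ such that $$\min\{\Phi(x^k+\delta^{m}d^k,\ \delta^{m}f_1(\tilde y^k)+(1-\delta^{m})U^k),\ F(\tilde y^k)\}\le\Phi(x^k,U^k)+\omega\delta^{m}\tilde\Delta_k,$$ and $\eta_k=\delta^{m_k}$ if $\Phi(x^k+\delta^{m_k}d^k,\ \delta^{m_k}f_1(\tilde y^k)+(1-\delta^{m_k})U^k)<F(\tilde y^k)$, while $\eta_k=1$ otherwise. Subdifferential: $\partial F(x)$ is the limiting (Mordukhovich) subdifferential in the sense of Rockafellar–Wets: $v\in\partial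 F(x)$ iff $F(x)$ is finite and there are $x_j\to x$ with $F(x_j)\to F(x)$ and $v_j\to v$ with $\liminf_{y\to x_j,\,y\ne x_j}\frac{F(y)-F(x_j)-\langle v_j,y-x_j\rangle}{\|y-x_j\|}\ge0$ for each $j$. *)

(* Defs.v *)
From HB Require Import structures.
From mathcomp Require Import all_boot all_order all_algebra.
From mathcomp Require Import all_classical all_reals all_analysis.
Set Implicit Arguments.
Unset Strict Implicit.
Unset Printing Implicit Defensive.
Import Order.TTheory GRing.Theory Num.Theory.
Import numFieldNormedType.Exports.
Local Open Scope classical_set_scope.
Local Open Scope ring_scope.
Local Open Scope ereal_scope.

(* R^n is 'rV[R]_n.  The library norm `|u| on 'rV[R]_n is the sup norm; it
   induces the usual topology, but every metric quantity below uses the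
   Euclidean norm enorm. *)

Definition dotp (R : realType) (n : nat) (u v : 'rV[R]_n) : R :=
  (\sum_(i < n) u ord0 i * v ord0 i)%R.

Definition enorm (R : realType) (n : nat) (u : 'rV[R]_n) : R :=
  Num.sqrt (dotp u u).

(* Meaningful where f is differentiable. *)
Definition grad (R : realType) (n : nat) (f : 'rV[R]_n -> R) (x : 'rV[R]_n) :
    'rV[R]_n :=
  \row_(i < n) 'D_(delta_mx ord0 i) f x.

Definition edom (R : realType) (n : nat) (f : 'rV[R]_n -> \bar R) :
    set 'rV[R]_n :=
  [set x | f x < +oo].

Definition proper_efun (R : realType) (n : nat) (f : 'rV[R]_n -> \bar R) : Prop :=
  (forall x, -oo < f x) /\ edom f !=set0.

(* The convention 0 * +oo = 0 makes the cases t = 0 and t = 1 trivial. *)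
Definition convex_efun (R : realType) (n : nat) (f : 'rV[R]_n -> \bar R) : Prop :=
  forall (x y : 'rV[R]_n) (t : R), (0 <= t <= 1)%R ->
    f (t *: x + (1 - t) *: y)%R <= t%:E * f x + (1 - t)%R%:E * f y.

Definition continuously_differentiable_on (R : realType) (n : nat)
    (A : set 'rV[R]_n) (f : 'rV[R]_n -> R) : Prop :=
  open A /\
  forall x, A x -> differentiable f x /\ {for x, continuous (grad f)}.

Definition elipschitz_on (R : realType) (n : nat) (L : R)
    (A : set 'rV[R]_n) (g : 'rV[R]_n -> 'rV[R]_n) : Prop :=
  forall x y, A x -> A y -> (enorm (g x - g y) <= L * enorm (x - y))%R.

Definition bounded_below (R : realType) (n : nat) (f : 'rV[R]_n -> \bar R) : Prop :=
  exists M : R, forall x, M%:E <= f x.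

Definition objective (R : realType) (n : nat) (f0 : 'rV[R]_n -> R)
    (f1 : 'rV[R]_n -> \bar R) (x : 'rV[R]_n) : \bar R :=
  (f0 x)%:E + f1 x.

(* The argmin is kept as a set; it is a singleton when f is proper, lower
   semicontinuous and convex and 0 < a. *)
Definition prox (R : realType) (n : nat) (a : R) (f : 'rV[R]_n -> \bar R)
    (z : 'rV[R]_n) : set 'rV[R]_n :=
  [set y | forall w, f y + ((2 * a)^-1 * enorm (y - z) ^+ 2)%R%:E
                  <= f w + ((2 * a)^-1 * enorm (w - z) ^+ 2)%R%:E].

(* The model <grad f0 x, y - x> + |y - x|^2 / (2 a) + f1 y - c.  At
   x = x^k, a = alpha_k it is H_k(y) for c = f1 x^k, and it is
   Delta_k for y = ytilde^k, c = U^k. *)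
Definition model (R : realType) (n : nat) (f0 : 'rV[R]_n -> R)
    (f1 : 'rV[R]_n -> \bar R) (a : R) (x : 'rV[R]_n) (c : \bar R)
    (y : 'rV[R]_n) : \bar R :=
  (dotp (grad f0 x) (y - x) + (2 * a)^-1 * enorm (y - x) ^+ 2)%R%:E
  + f1 y - c.

Definition Hmodel (R : realType) (n : nat) (f0 : 'rV[R]_n -> R)
    (f1 : 'rV[R]_n -> \bar R) (a : R) (x y : 'rV[R]_n) : \bar R :=
  model f0 f1 a x (f1 x) y.

Definition Delta (R : realType) (n : nat) (f0 : 'rV[R]_n -> R)
    (f1 : 'rV[R]_n -> \bar R) (a : R) (x : 'rV[R]_n) (u : R)
    (y : 'rV[R]_n) : \bar R :=
  model f0 f1 a x u%:E y.

(* Extended to u = +oo so that it applies to combinations of f1 y and U^k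
   without truncating f1 y. *)
Definition Phi (R : realType) (n : nat) (f0 : 'rV[R]_n -> R)
    (x : 'rV[R]_n) (u : \bar R) : \bar R :=
  (f0 x)%:E + u.

(* The value of Phi after a step of length t from (x, u) towards (y, f1 y). *)
Definition trial (R : realType) (n : nat) (f0 : 'rV[R]_n -> R)
    (f1 : 'rV[R]_n -> \bar R) (x : 'rV[R]_n) (u : R) (y : 'rV[R]_n) (t : R) :
    \bar R :=
  Phi f0 (x + t *: (y - x))%R (t%:E * f1 y + ((1 - t) * u)%R%:E).

Definition sufficient_decrease (R : realType) (n : nat) (f0 : 'rV[R]_n -> R)
    (f1 : 'rV[R]_n -> \bar R) (omega a : R) (x : 'rV[R]_n) (u : R)
    (y : 'rV[R]_n) (t : R) : Prop :=
  Order.min (trial f0 f1 x u y t) (objective f0 f1 y)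
    <= Phi f0 x u%:E + (omega * t)%R%:E * Delta f0 f1 a x u y.

(* x^' is the filter of punctured neighbourhoods of x. *)
Definition regular_subdiff (R : realType) (n : nat) (f : 'rV[R]_n -> \bar R)
    (x : 'rV[R]_n) : set 'rV[R]_n :=
  [set v | f x \is a fin_num /\
    0 <= limf_einf (fun y => (f y - f x - (dotp v (y - x))%:E)
                             * (enorm (y - x))^-1%:E) x^'].

Definition limiting_subdiff (R : realType) (n : nat) (f : 'rV[R]_n -> \bar R)
    (x : 'rV[R]_n) : set 'rV[R]_n :=
  [set v | f x \is a fin_num /\
    exists xs vs : nat -> 'rV[R]_n,
      [/\ xs @ \oo --> x, f \o xs @ \oo --> f x, vs @ \oo --> v
        & forall j, regular_subdiff f (xs j) (vs j)]].

Definition stationary (R : realType) (n : nat) (f : 'rV[R]_n -> \bar R)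
    (x : 'rV[R]_n) : Prop :=
  edom f x /\ limiting_subdiff f x 0%R.

(* Main.v *)
Require Import Defs.
From HB Require Import structures.
From mathcomp Require Import all_boot all_order all_algebra.
From mathcomp Require Import ring lra.
From mathcomp Require Import all_classical all_reals all_analysis.
Set Implicit Arguments.
Unset Strict Implicit.
Unset Printing Implicit Defensive.
Import Order.TTheory GRing.Theory Num.Theory.
Import numFieldNormedType.Exports.
Local Open Scope classical_set_scope.
Local Open Scope ring_scope.

(** The merit values [P k = f0 (x k) + U k] form a Lyapunov sequence.
    Convexity gives [f1 (x k) <= U k], so [P k] dominates [F (x k)] and is
    bounded from below.  The inexactness condition forces the predicted
    decrease [D k] (the value of the model at [yt k]) to be nonpositive, because
    [yh k] minimizes the model ([inexact_minimizer]); hence every accepted step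
    decreases [P] by at least [omega * delta ^+ m k * - D k]
    ([accepted_step_decrease]).

    Backtracking cannot shrink the step indefinitely: the descent lemma on the
    convex set [edom f1] shows that every [t] in (0, 1] with
    [L * t <= (alpha k)^-1] is accepted ([sufficient_decrease_small_step]), so
    [delta ^+ m k] is bounded away from [0] ([backtracking_step_ge]).  Therefore [D k] tends to [0].

    The inexactness condition also bounds the minimum of the model from below
    by [(1 + mu / 2) * D k], which tends to [0].  This says that
    [f1] lies above a concave quadratic function:
    [f1 y >= U k + o(1) - <grad f0 (x k), y - x k> - C * |y - x k|^2]
    with [C = (2 * alpha_min)^-1] independent of [k].  All terms pass to the
    limit along a subsequence converging to [xs].  Taking [y = xs] bounds
    [f1 xs] from below by the limit of [U]; lower semicontinuity and
    [f1 (x k) <= U k] give the opposite inequality.  Thus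
    [F xs = lim P], and
    [f1 y >= f1 xs - <grad f0 xs, y - xs> - C * |y - xs|^2] for all [y]
    ([limit_of_models_stationary]).  The quadratic term is negligible at first
    order, so [0] is a regular subgradient of [F] at [xs]
    ([stationary_objective]). *)

(** * Euclidean structure *)

Section Euclidean.
Context {R : realType} {n : nat}.
Implicit Types (u v w : 'rV[R]_n) (a : R).

Lemma dotpC u v : dotp u v = dotp v u.
Proof. by apply: eq_bigr => i _; rewrite mulrC. Qed.

Lemma dotpDr u v w : dotp u (v + w) = dotp u v + dotp u w.
Proof. by rewrite -big_split; apply: eq_bigr => i _; rewrite mxE mulrDr. Qed.

Lemma dotpZr a u v : dotp u (a *: v) = a * dotp u v.
Proof. by rewrite mulr_sumr; apply: eq_bigr => i _; rewrite mxE mulrCA. Qed.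

Lemma dotpDl u v w : dotp (u + v) w = dotp u w + dotp v w.
Proof. by rewrite dotpC dotpDr !(dotpC w). Qed.

Lemma dotpZl a u v : dotp (a *: u) v = a * dotp u v.
Proof. by rewrite dotpC dotpZr dotpC. Qed.

Lemma dotpNl u v : dotp (- u) v = - dotp u v.
Proof. by rewrite -scaleN1r dotpZl mulN1r. Qed.

Lemma dotpNr u v : dotp u (- v) = - dotp u v.
Proof. by rewrite dotpC dotpNl dotpC. Qed.

Lemma dotp0r u : dotp u 0 = 0.
Proof. by rewrite -(scale0r u) dotpZr mul0r. Qed.

Lemma dotp_ge0 u : 0 <= dotp u u.
Proof. by apply: sumr_ge0 => i _; rewrite -expr2 sqr_ge0. Qed.

Lemma enorm_ge0 u : 0 <= enorm u.
Proof. exact: sqrtr_ge0. Qed.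

Lemma enorm0 : enorm (0 : 'rV[R]_n) = 0.
Proof. by rewrite /enorm dotp0r sqrtr0. Qed.

Lemma enorm_sqr u : enorm u ^+ 2 = dotp u u.
Proof. by rewrite sqr_sqrtr// dotp_ge0. Qed.

Lemma enormZ a u : enorm (a *: u) = `|a| * enorm u.
Proof.
by rewrite /enorm dotpZl dotpZr mulrA -expr2 sqrtrM ?sqr_ge0// sqrtr_sqr.
Qed.

(** Passes from remainders measured in the sup norm of ['rV_n], which defines
    differentiability, to the Euclidean norm. *)
Lemma normr_le_enorm u : `|u| <= enorm u.
Proof.
rewrite [leLHS]mx_normrE; apply/bigmax_leP; split; first exact: enorm_ge0.
move=> [i j] _ /=; rewrite (ord1 i) -sqrtr_sqr ler_sqrt ?dotp_ge0//.
rewrite /dotp (bigD1 j)//= -expr2 lerDl.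
by apply: sumr_ge0 => k _; rewrite -expr2 sqr_ge0.
Qed.

Lemma enorm_eq0 u : enorm u = 0 -> u = 0.
Proof.
by move=> u0; apply/eqP; rewrite -normr_le0 -u0; exact: normr_le_enorm.
Qed.

Lemma enorm_gt0 u : u != 0 -> 0 < enorm u.
Proof.
move=> u0; rewrite lt0r enorm_ge0 andbT.
by apply: contra u0 => /eqP /enorm_eq0 ->.
Qed.

Lemma dotp_le_enorm u v : dotp u v <= enorm u * enorm v.
Proof.
have [->|u0] := eqVneq u 0; first by rewrite dotpC dotp0r mulr_ge0 ?enorm_ge0.
have [->|v0] := eqVneq v 0; first by rewrite dotp0r mulr_ge0 ?enorm_ge0.
(* In the nondegenerate case the vector |v| u - |u| v has nonnegative square,
   namely 2 |u| |v| (|u| |v| - <u, v>). *)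
have := dotp_ge0 (enorm v *: u - enorm u *: v).
rewrite !(dotpDl, dotpDr, dotpNl, dotpNr, dotpZl, dotpZr) -!enorm_sqr.
rewrite (dotpC v u).
have := enorm_gt0 u0; have := enorm_gt0 v0.
set a := enorm u; set b := enorm v; set c := dotp u v => b0 a0.
move=> sq; have : 0 <= 2 * (a * b) * (a * b - c) by lra.
by rewrite pmulr_rge0 ?subr_ge0// !mulr_gt0.
Qed.

Lemma cvg_dotp {T} {F : set_system T} {FF : Filter F}
    (f g : T -> 'rV[R]_n) u v :
  f @ F --> u -> g @ F --> v -> (fun t => dotp (f t) (g t)) @ F --> dotp u v.
Proof.
move=> fu gv; apply: cvg_big => [|i _]; first exact: add_continuous.
apply: cvgM.
- exact: (cvg_comp _ _ fu (@coord_continuous _ _ _ ord0 i u)).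
- exact: (cvg_comp _ _ gv (@coord_continuous _ _ _ ord0 i v)).
Qed.

Lemma cvg_enorm {T} {F : set_system T} {FF : Filter F} (f : T -> 'rV[R]_n) u :
  f @ F --> u -> (fun t => enorm (f t)) @ F --> enorm u.
Proof.
move=> fu; have uu : (fun t => dotp (f t) (f t)) @ F --> dotp u u.
  exact: cvg_dotp.
by apply: (cvg_comp _ _ uu); exact: sqrt_continuous.
Qed.

End Euclidean.

(** * Smooth functions *)

Section Calculus.
Context {R : realType} {n : nat}.
Implicit Types (f : 'rV[R]_n -> R) (x d : 'rV[R]_n).

Lemma diff_dotp_grad f x d : differentiable f x -> 'd f x d = dotp (grad f x) d.
Proof.
move=> fx; rewrite {1}(row_sum_delta d) linear_sum.
apply: eq_bigr => i _; by rewrite linearZ/= mxE deriveE// mulrC.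
Qed.

Lemma is_derive_line f x d t : differentiable f (x + t *: d) ->
  is_derive t (1:R) (fun s : R => f (x + s *: d))
    (dotp (grad f (x + t *: d)) d).
Proof.
move=> fx.
have E : (fun h : R => h^-1 *: (((fun s : R => f (x + s *: d)) \o shift t) (h *: 1)
   - f (x + t *: d))) =
  (fun h : R => h^-1 *: ((f \o shift (x + t *: d)) (h *: d) - f (x + t *: d))).
  apply/funext => h /=; congr (_ *: (f _ - _)).
  by rewrite scalerDl [h *: 1]mulr1 addrCA.
split.
- by rewrite /derivable E; exact: diff_derivable.
- by rewrite /derive E -/('D_d f _) deriveE// diff_dotp_grad.
Qed.

(** The descent lemma.  Only the segment from [x] to [x + d] has to lie in the
    set [A] where the gradient is Lipschitz, so that [A] can be the domain of a
    convex function.  The mean value theorem is applied to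
    [f (x + t d) - t <grad f x, d> - t^2 L |d|^2 / 2], whose derivative is
    nonpositive by Cauchy-Schwarz. *)
Lemma descent (A : set 'rV[R]_n) L f x d :
  (forall y, A y -> differentiable f y) -> elipschitz_on L A (grad f) ->
  (forall t : R, 0 <= t <= 1 -> A (x + t *: d)) ->
  f (x + d) <= f x + dotp (grad f x) d + L / 2 * dotp d d.
Proof.
move=> fA lipA Axd.
have Ax : A x.
  by have := Axd 0; rewrite scale0r addr0; apply; rewrite lexx ler01.
pose dphi t := dotp (grad f (x + t *: d)) d - dotp (grad f x) d
  - L * dotp d d * t.
pose phi t := f (x + t *: d) - dotp (grad f x) d * t
  - L / 2 * dotp d d * t ^+ 2.
have dphiE (t : R) : 0 <= t <= 1 -> is_derive t (1:R) phi (dphi t).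
  move=> t01; have dt := is_derive_line (fA _ (Axd _ t01)).
  apply: is_derive_eq.
  by rewrite /dphi /GRing.scale/=; field.
have [||t] := @MVT_segment R phi dphi 0 1 ler01.
- by move=> t; rewrite in_itv/= => /andP[t0 t1]; apply: dphiE; rewrite !ltW.
- apply: derivable_within_continuous => t; rewrite in_itv/= => t01.
  exact: (@ex_derive _ _ _ _ _ _ _ (dphiE _ t01)).
rewrite in_itv/= => t01; rewrite subr0 mulr1 => phiE.
have dphi_le0 : dphi t <= 0.
  have := dotp_le_enorm (grad f (x + t *: d) - grad f x) d.
  have := lipA _ _ (Axd _ t01) Ax; rewrite addrAC subrr add0r enormZ.
  case/andP: (t01) => t0 _; rewrite (ger0_norm t0) => lip.
  have := ler_wpM2r (enorm_ge0 d) lip.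
  rewrite /dphi -enorm_sqr dotpDl dotpNl; lra.
move: dphi_le0; rewrite -phiE /phi scale1r scale0r addr0.
by rewrite expr0n/=; lra.
Qed.

Lemma cvg_subr0 x : (fun y => y - x) @ x --> (0 : 'rV[R]_n).
Proof.
rewrite -(subrr x).
exact: (@cvgB _ _ _ (nbhs x) _ id (cst x) x x cvg_id (cvg_cst x)).
Qed.

Lemma first_order_expansion f x (e : R) : differentiable f x -> 0 < e ->
  \forall y \near x,
    `|f y - f x - dotp (grad f x) (y - x)| <= e * enorm (y - x).
Proof.
move=> fx e0.
have /eqaddoP /(_ e e0) near0 := diff_locally fx.
have := @cvg_subr0 x _ near0; rewrite nbhs_simpl/=; apply: filterS => y /=.
rewrite !fctE/= subrK diff_dotp_grad// opprD addrA => fy.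
by apply: (le_trans fy); rewrite ler_pM2l//; exact: normr_le_enorm.
Qed.

End Calculus.

(** * Stationary points of a composite objective *)

Section Stationarity.
Context {R : realType} {n : nat}.
Implicit Types (x v : 'rV[R]_n).

Lemma limf_einf_ge0 {T : choiceType} {X : filteredType T} (g : X -> \bar R)
    (F : set_system X) :
  (forall e : R, 0 < e -> \forall y \near F, ((- e)%:E <= g y)%E) ->
  (0 <= limf_einf g F)%E.
Proof.
move=> gF; rewrite limf_einfE; apply/lee_subgt0Pr => e e0.
rewrite sub0e -EFinN; apply: le_trans (ereal_sup_ubound _); last first.
  by exists [set y | ((- e)%:E <= g y)%E] => //; exact: gF.
by apply: le_ereal_inf_tmp => _ [y /= gy <-].
Qed.

Lemma regular_subdiffW (f : 'rV[R]_n -> \bar R) x v :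
  regular_subdiff f x v -> limiting_subdiff f x v.
Proof.
move=> fv; split; first by case: fv.
by exists (fun=> x), (fun=> v); split => //; exact: cvg_cst.
Qed.

(** A quadratic term is negligible at first order, so the hypothesis says that
    [- grad f0 x] behaves like a subgradient of [f1] at [x]; it cancels the
    gradient of [f0] and leaves [0] as a regular subgradient of the sum. *)
Lemma stationary_objective (f0 : 'rV[R]_n -> R) (f1 : 'rV[R]_n -> \bar R) x c C :
  differentiable f0 x -> f1 x = c%:E ->
  (forall y, ((c - dotp (grad f0 x) (y - x) - C * dotp (y - x) (y - x))%:E
              <= f1 y)%E) ->
  stationary (objective f0 f1) x.
Proof.
move=> dx f1x lef1; split; first by rewrite /edom/= /objective f1x -EFinD ltry.
apply: regular_subdiffW; split; first by rewrite /objective f1x.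
apply: limf_einf_ge0 => e e0.
(* Where |y - x| < e / (2 K), the quadratic term is at most e / 2 * |y - x|;
   the remainder of f0 uses the other half of e. *)
pose K := `|C| + 1.
have K0 : 0 < K by rewrite ltr_wpDl.
have e20 : 0 < e / 2 by rewrite divr_gt0.
have first_order := first_order_expansion dx e20.
have small : \forall y \near x, enorm (y - x) < e / 2 / K.
  have yx0 : (fun y => enorm (y - x)) @ x --> (0 : R).
    rewrite -(@enorm0 R n).
    exact: (@cvg_enorm _ _ _ (nbhs x) _ (fun y => y - x) 0 (@cvg_subr0 _ _ x)).
  by apply: (cvgr_lt _ yx0); rewrite divr_gt0.
rewrite near_withinE; apply: filterS2 first_order small => y fo sm yx.
have := yx; rewrite -subr_eq0 => /enorm_gt0 yx0.
have qE := enorm_sqr (y - x).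
have main : ((- e * enorm (y - x))%:E
    <= objective f0 f1 y - objective f0 f1 x - (dotp 0 (y - x))%:E)%E.
  rewrite dotpC dotp0r sube0 /objective f1x.
  have := lef1 y; case: (f1 y) => [r| |]//; last first.
    by move=> _; rewrite leey.
  rewrite lee_fin -!EFinD lee_fin -qE.
  have : K * enorm (y - x) ^+ 2 <= e / 2 * enorm (y - x).
    by rewrite expr2 mulrA ler_pM2r// mulrC -ler_pdivlMr// ltW.
  have : C * enorm (y - x) ^+ 2 <= K * enorm (y - x) ^+ 2.
    by rewrite ler_wpM2r ?sqr_ge0// ler_wpDr// ler_norm.
  by move: fo; rewrite ler_norml => /andP[]; lra.
rewrite lee_pdivlMr//; exact: main.
Qed.

End Stationarity.

(** * One iteration of the method *)

Section OneIteration.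
Context {R : realType} {n : nat}.
Variables (f0 : 'rV[R]_n -> R) (f1 : 'rV[R]_n -> \bar R).
Implicit Types (x y z d : 'rV[R]_n) (a u p v w t D : R).

Definition smooth_model a x y : R :=
  dotp (grad f0 x) (y - x) + (2 * a)^-1 * enorm (y - x) ^+ 2.

Lemma edom_fin_num x : (-oo < f1 x)%E -> edom f1 x -> f1 x = (fine (f1 x))%:E.
Proof. by move=> f1x xdom; rewrite fineK// fin_numE gt_eqF// lt_eqF. Qed.

Lemma prox_edom a c x z : edom f1 x -> prox a f1 c z -> edom f1 z.
Proof.
move=> xdom /(_ x); move: xdom; rewrite /edom/=.
by case: (f1 z) => [r _ _| |//]; [rewrite ltry|case: (f1 x)].
Qed.

(** Completing the square: the proximal objective centred at the gradient step
    and the model differ by a constant. *)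
Lemma prox_minimizes_model a x z w y v : 0 < a ->
  prox a f1 (x - a *: grad f0 x) z -> f1 z = w%:E -> f1 y = v%:E ->
  smooth_model a x z + w <= smooth_model a x y + v.
Proof.
move=> a0 /(_ y) + f1z f1y; rewrite f1z f1y -!EFinD lee_fin.
have square c : (2 * a)^-1 * enorm (c - (x - a *: grad f0 x)) ^+ 2 =
    smooth_model a x c + a / 2 * dotp (grad f0 x) (grad f0 x).
  have -> : c - (x - a *: grad f0 x) = (c - x) + a *: grad f0 x.
    by rewrite opprB addrCA addrC.
  rewrite /smooth_model !enorm_sqr.
  move: (c - x) => b; rewrite dotpDl !dotpDr !dotpZl !dotpZr.
  rewrite (dotpC b (grad _ _)).
  by field; exact: lt0r_neq0.
by rewrite !square; lra.
Qed.

(** The gap in the model value at [y] is nonnegative and at most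
    [- mu / 2 * D], which gives both the sign of [D] and a lower bound on the
    minimum of the model. *)
Lemma inexact_minimizer a mu x p u y v z w : 0 < a -> 0 < mu ->
  prox a f1 (x - a *: grad f0 x) z ->
  f1 x = p%:E -> f1 y = v%:E -> f1 z = w%:E ->
  (Hmodel f0 f1 a x y - Hmodel f0 f1 a x z
     <= (- (mu / 2))%:E * Delta f0 f1 a x u y)%E ->
  let D := smooth_model a x y + v - u in
  D <= 0 /\ u + (1 + mu / 2) * D <= smooth_model a x z + w.
Proof.
move=> a0 mu0 zprox f1x f1y f1z.
rewrite /Hmodel /Delta /model f1x f1y f1z.
rewrite -/(smooth_model a x y) -/(smooth_model a x z).
rewrite -!EFinD -EFinM lee_fin.
have := prox_minimizes_model a0 zprox f1z f1y.
set H := smooth_model _ _ y; set h := smooth_model _ _ z => hH gap.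
set D := H + v - u.
have D0 : D <= 0.
  have : 0 <= - (mu / 2) * D by rewrite /D; lra.
  by rewrite mulNr oppr_ge0 pmulr_rle0// divr_gt0.
by split=> //; move: D0 gap; rewrite /D; lra.
Qed.

Lemma sufficient_decreaseE omega a x u y v t : f1 y = v%:E ->
  sufficient_decrease f0 f1 omega a x u y t <->
  Num.min (f0 (x + t *: (y - x)) + (t * v + (1 - t) * u)) (f0 y + v)
    <= f0 x + u + omega * t * (smooth_model a x y + v - u).
Proof.
move=> f1y.
rewrite /sufficient_decrease /trial /objective /Phi /Delta /model f1y.
by rewrite -!(EFinD, EFinM) -EFin_min lee_fin.
Qed.

(** When [L * t <= a^-1], the quadratic error of the descent lemma is absorbed by
    the proximal term of the model, so the trial value drops by at least [- t * D],
    hence by [- omega * t * D]. *)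
Lemma sufficient_decrease_small_step omega a L x u y v t :
  0 < a -> 0 < t -> omega < 1 -> f1 y = v%:E ->
  smooth_model a x y + v - u <= 0 ->
  f0 (x + t *: (y - x)) <= f0 x + dotp (grad f0 x) (t *: (y - x))
    + L / 2 * dotp (t *: (y - x)) (t *: (y - x)) ->
  L * t <= a^-1 -> sufficient_decrease f0 f1 omega a x u y t.
Proof.
move=> a0 t0 om1 f1y D0 desc Lt; apply/(sufficient_decreaseE _ _ _ _ _ f1y).
rewrite ge_min; apply/orP; left; apply: le_trans (lerD desc (lexx _)) _.
move: D0; rewrite !dotpZl !dotpZr /smooth_model enorm_sqr.
have := dotp_ge0 (y - x); set N := dotp (y - x) _ => N0.
set G := dotp (grad f0 x) (y - x).
set D := G + _ + v - u => D0.
have : 0 <= t * ((1 - omega) * - D).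
  apply: mulr_ge0; first exact: ltW.
  by apply: mulr_ge0; rewrite ?oppr_ge0 ?subr_ge0// ltW.
have : 0 <= t * ((a^-1 - L * t) * N).
  by apply: mulr_ge0; [exact: ltW|apply: mulr_ge0; rewrite ?subr_ge0].
rewrite /D invfM; lra.
Qed.

(** When the full step is preferred, the new merit value is [objective y]
    itself; in both cases it is the minimum tested by the line search. *)
Lemma accepted_step_decrease omega a x u y v t e : f1 y = v%:E ->
  sufficient_decrease f0 f1 omega a x u y t ->
  e = (if (trial f0 f1 x u y t < objective f0 f1 y)%E then t else 1) ->
  f0 (x + e *: (y - x)) + (e * v + (1 - e) * u)
    <= f0 x + u + omega * t * (smooth_model a x y + v - u).
Proof.
move=> f1y /(sufficient_decreaseE _ _ _ _ _ f1y) accept ->.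
apply: le_trans accept; rewrite /trial /objective /Phi f1y.
rewrite -!(EFinD, EFinM) lte_fin le_min.
case: ltP => [/ltW lt|le]; first by rewrite lexx lt.
by rewrite scale1r (addrC x) subrK mul1r subrr mul0r addr0 le lexx.
Qed.

End OneIteration.

Section ConvexDomain.
Context {R : realType} {n : nat}.
Variable (f1 : 'rV[R]_n -> \bar R).

Lemma convex_efun_fin x y p v (t : R) : convex_efun f1 -> 0 <= t <= 1 ->
  f1 x = p%:E -> f1 y = v%:E ->
  (f1 (x + t *: (y - x)) <= (t * v + (1 - t) * p)%:E)%E.
Proof.
move=> cvx t01 f1x f1y; have := cvx y x t t01.
by rewrite f1x f1y scalerBl scale1r scalerBr addrCA.
Qed.

End ConvexDomain.

(** If backtracking goes beyond [delta ^+ j], that step is rejected, hence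
    [L * delta ^+ j > a^-1]; the next step is shorter by the factor [delta] only.
    The constant [`|L| + 1] replaces [L] to keep the denominator positive. *)
Lemma backtracking_step_ge (R : realType) (accepted : R -> Prop)
    (delta L a amax : R) (m : nat) :
  0 < delta < 1 -> 0 < a <= amax ->
  (forall t, 0 < t <= 1 -> L * t <= a^-1 -> accepted t) ->
  (forall j, accepted (delta ^+ j) -> (m <= j)%N) ->
  Num.min 1 (delta / ((`|L| + 1) * amax)) <= delta ^+ m.
Proof.
move=> /andP[delta0 delta1] /andP[a0 a_amax] small_accepted m_least.
have amax0 : 0 < amax by exact: lt_le_trans a_amax.
have L0 : 0 < `|L| + 1 by rewrite ltr_wpDl.
case: m m_least => [|j] m_least; first by rewrite expr0 ge_min lexx.
rewrite ge_min; apply/orP; right.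
rewrite exprS ler_pM2l// leNgt; apply/negP => dj.
suff /m_least : accepted (delta ^+ j) by rewrite ltnn.
have dj0 : 0 < delta ^+ j by rewrite exprn_gt0.
apply: small_accepted; first by rewrite dj0/= exprn_ile1// ltW.
apply: (@le_trans _ _ amax^-1); last by rewrite lef_pV2 ?posrE.
apply: (@le_trans _ _ ((`|L| + 1) * delta ^+ j)).
  by rewrite ler_wpM2r ?(ltW dj0)// ler_wpDr// ler_norm.
by move: dj; rewrite invfM => /ltW; rewrite -ler_pdivlMl.
Qed.

(** * Passing to the limit *)

Section Limits.
Context {R : realType}.

Lemma cvg_to0_of_decrease (P e : nat -> R) (M : R) :
  (forall k, M <= P k) -> (forall k, 0 <= e k) ->
  (forall k, P k.+1 <= P k - e k) ->
  exists2 l : R, P @ \oo --> l & e @ \oo --> (0 : R).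
Proof.
move=> PM e0 Pe.
have Pdecr : nonincreasing_seq P.
  by apply/nonincreasing_seqP => k; apply: le_trans (Pe k) _; rewrite gerBl.
have Pcvg : cvgn P.
  apply: nonincreasing_is_cvgn => //.
  by exists M => _ [k _ <-].
exists (lim (P @ \oo)); first exact: Pcvg.
have P'cvg : (fun k => P k.+1) @ \oo --> lim (P @ \oo).
  by have := Pcvg; rewrite -(cvg_shiftS P).
have diffcvg : (fun k => P k - P k.+1) @ \oo --> (0 : R).
  by rewrite -(subrr (lim (P @ \oo))); exact: cvgB.
apply: (squeeze_cvgr _ (cvg_cst 0) diffcvg).
by apply: nearW => k; rewrite e0/= lerBrDr addrC -lerBrDr Pe.
Qed.

(** The index [phi j] is chosen beyond [j] and within distance [1 / (j + 1)] of
    [p].  Tending to infinity is what transports the limits of other sequences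
    along [phi], so [phi] is not made increasing. *)
Lemma cluster_subsequence {V : pseudoMetricType R} (x : nat -> V) p :
  cluster (x @ \oo) p ->
  exists2 phi : nat -> nat, phi @ \oo --> \oo & x \o phi @ \oo --> p.
Proof.
move=> xp.
have /choice[phi phiP] (j : nat) :
    exists k, (j <= k)%N /\ ball p j.+1%:R^-1 (x k).
  have : (x @ \oo) (x @` [set k | (j <= k)%N]).
    by exists j => // k /= jk; exists k.
  have bp : nbhs p (ball p (j.+1%:R^-1 : R)).
    by apply: nbhsx_ballx; rewrite invr_gt0.
  by move=> /xp /(_ bp) [_ [[k jk <-] xk]]; exists k.
exists phi.
  move=> A [N _ NA]; exists N => // k /= Nk; apply: NA => /=.
  by apply: leq_trans Nk _; case: (phiP k).
apply/cvg_ballP => _/posnumP[e]; near=> j => /=.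
apply: (@le_ball _ _ p j.+1%:R^-1); last by case: (phiP j).
by apply: ltW; near: j; exact: near_infty_natSinv_lt.
Unshelve. all: by end_near.
Qed.

End Limits.

Section LimitPoint.
Context {R : realType} {n : nat}.
Variables (f0 : 'rV[R]_n -> R) (f1 : 'rV[R]_n -> \bar R).

Lemma lsc_le_lim (x : nat -> 'rV[R]_n) (U : nat -> R) xs (l : R) :
  lower_semicontinuous f1 -> x @ \oo --> xs -> U @ \oo --> l ->
  (forall k, f1 (x k) <= (U k)%:E)%E -> (f1 xs <= l%:E)%E.
Proof.
move=> lsc xcvg Ucvg f1U; rewrite leNgt; apply/negP => lf1.
have [a la af1] : exists2 a : R, l < a & (a%:E < f1 xs)%E.
  case: (f1 xs) lf1 => [r| |//] lr.
    by exists ((l + r) / 2); rewrite ?lte_fin !(midf_lt lr).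
  by exists (l + 1); rewrite ?ltrDl// ltry.
have [V xV Va] := lsc _ _ af1.
suff : a <= l by rewrite leNgt la.
apply: (@cvgr_to_ge _ _ _ _ _ _ _ Ucvg).
have := xcvg _ xV; rewrite nbhs_simpl/=; apply: filterS => k /Va af.
by rewrite -lee_fin; exact: le_trans (ltW af) (f1U k).
Qed.

(** The lower bounds on [f1] pass to the limit pointwise in [y].  At [y = xs]
    the limiting bound meets the upper bound coming from lower semicontinuity,
    which identifies [f1 xs] with the limit of [U]; for the other [y] it is the
    hypothesis of [stationary_objective]. *)
Lemma limit_of_models_stationary (x : nat -> 'rV[R]_n) (U e : nat -> R) xs
    (l C : R) :
  lower_semicontinuous f1 -> differentiable f0 xs ->
  {for xs, continuous (grad f0)} -> x @ \oo --> xs ->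
  (fun k => f0 (x k) + U k) @ \oo --> l -> e @ \oo --> (0 : R) ->
  (forall k, f1 (x k) <= (U k)%:E)%E ->
  (forall k y, ((U k + e k - dotp (grad f0 (x k)) (y - x k)
                 - C * dotp (y - x k) (y - x k))%:E <= f1 y)%E) ->
  stationary (objective f0 f1) xs /\ objective f0 f1 xs = l%:E.
Proof.
move=> lsc diff0 grad0 xcvg Pcvg ecvg f1U model_le.
have f0cvg : f0 \o x @ \oo --> f0 xs.
  exact: (cvg_comp _ _ xcvg (differentiable_continuous diff0)).
have gcvg : (grad f0 \o x) @ \oo --> grad f0 xs.
  exact: (cvg_comp _ _ xcvg grad0).
have Ucvg : U @ \oo --> l - f0 xs.
  have -> : U = (fun k => f0 (x k) + U k) - (f0 \o x).
    by apply/funext => k; rewrite !fctE/= addrAC subrr add0r.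
  exact: cvgB.
have model_lim y : ((l - f0 xs - dotp (grad f0 xs) (y - xs)
                 - C * dotp (y - xs) (y - xs))%:E <= f1 y)%E.
  have dcvg : (fun k => y - x k) @ \oo --> y - xs.
    by apply: cvgB => //; exact: cvg_cst.
  have lcvg : (fun k => U k + e k - dotp (grad f0 (x k)) (y - x k)
      - C * dotp (y - x k) (y - x k)) @ \oo -->
    l - f0 xs - dotp (grad f0 xs) (y - xs) - C * dotp (y - xs) (y - xs).
    apply: cvgB; last by apply: cvgM; [exact: cvg_cst|exact: cvg_dotp].
    apply: cvgB; last exact: cvg_dotp.
    by rewrite -[l - f0 xs]addr0; exact: cvgD.
  case f1y : (f1 y) => [r| |]; last 2 first.
  - by rewrite leey.
  - by have := model_le 0%N y; rewrite f1y.
  rewrite lee_fin; apply: (@cvgr_to_le _ _ _ _ _ _ _ lcvg).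
  by apply: nearW => k; have := model_le k y; rewrite f1y lee_fin.
have f1xs : f1 xs = (l - f0 xs)%:E.
  apply/eqP; rewrite eq_le (lsc_le_lim lsc xcvg Ucvg f1U)/=.
  by have := model_lim xs; rewrite subrr !dotp0r mulr0 !subr0.
split; first exact: (stationary_objective diff0 f1xs model_lim).
by rewrite /objective f1xs -EFinD addrC subrK.
Qed.

End LimitPoint.

(** * Convergence of the method *)

Theorem theorem1 (R : realType) (n : nat)
  (f0 : 'rV[R]_n -> R) (f1 : 'rV[R]_n -> \bar R) (L : R)
  (* [A1] *)
  (f1_proper : proper_efun f1)
  (f1_lsc : lower_semicontinuous f1)
  (f1_convex : convex_efun f1)
  (* [A2] *)
  (f0_C1 : exists2 Omega0 : set 'rV[R]_n,
     closure (edom f1) `<=` Omega0 & continuously_differentiable_on Omega0 f0)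
  (* [A3] *)
  (grad_lip : elipschitz_on L (edom f1) (grad f0))
  (* [A4] *)
  (F_bounded : bounded_below (objective f0 f1))
  (alpha_min alpha_max delta omega : R)
  (alpha_min_gt0 : 0 < alpha_min) (alpha_min_max : alpha_min <= alpha_max)
  (delta01 : 0 < delta < 1) (omega01 : 0 < omega < 1)
  (x yt yh : nat -> 'rV[R]_n) (U alpha eta : nat -> R) (m : nat -> nat)
  (x0_dom : edom f1 (x 0%N))
  (eta01 : forall k, 0 < eta k <= 1)
  (x_step : forall k, x k.+1 = x k + eta k *: (yt k - x k))
  (* [S1] *)
  (U_init : (U 0%N)%:E = f1 (x 0%N))
  (U_step : forall k, ((U k.+1)%:E
     = (eta k)%:E * f1 (yt k) + ((1 - eta k) * U k)%R%:E)%E)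
  (* [S2] *)
  (alpha_bounds : forall k, alpha_min <= alpha k <= alpha_max)
  (yh_prox : forall k, prox (alpha k) f1 (x k - alpha k *: grad f0 (x k)) (yh k))
  (yt_inexact : exists2 mu : R, 0 < mu & forall k,
     (Hmodel f0 f1 (alpha k) (x k) (yt k) - Hmodel f0 f1 (alpha k) (x k) (yh k)
      <= (- (mu / 2))%R%:E * Delta f0 f1 (alpha k) (x k) (U k) (yt k))%E)
  (* [S3] *)
  (m_accept : forall k,
     sufficient_decrease f0 f1 omega (alpha k) (x k) (U k) (yt k) (delta ^+ m k))
  (m_least : forall k j,
     sufficient_decrease f0 f1 omega (alpha k) (x k) (U k) (yt k) (delta ^+ j) ->
     (m k <= j)%N)
  (eta_def : forall k, eta k =
     if (trial f0 f1 (x k) (U k) (yt k) (delta ^+ m k)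
         < objective f0 f1 (yt k))%E
     then delta ^+ m k else 1) :
  forall xs : 'rV[R]_n, cluster (x @ \oo) xs ->
    stationary (objective f0 f1) xs /\
    (fun k => Phi f0 (x k) (U k)%:E) @ \oo --> objective f0 f1 xs.
Proof.
move=> xs xs_lim.
have [S0 domS [_ f0_diff]] := f0_C1.
have [mu mu0 inexact] := yt_inexact.
have [f1_ninfty _] := f1_proper.
have alpha0 k : 0 < alpha k.
  by have /andP[+ _] := alpha_bounds k; exact: lt_le_trans.
have diff0 y : edom f1 y -> differentiable f0 y.
  by move=> ydom; have [] := f0_diff _ (domS _ (subset_closure ydom)).
pose v k := fine (f1 (yt k)).
(* An infinite value at [yt k] would propagate to [U k.+1] since eta k > 0. *)
have f1yt k : f1 (yt k) = (v k)%:E.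
  apply: edom_fin_num => //; rewrite /edom/= ltey; apply/negP => /eqP f1y.
  have /andP[eta0 _] := eta01 k.
  by have := U_step k; rewrite f1y gt0_muley ?lte_fin// addye.
have UE k : U k.+1 = eta k * v k + (1 - eta k) * U k.
  by apply: EFin_inj; rewrite U_step f1yt.
have f1x_le k : (f1 (x k) <= (U k)%:E)%E.
  elim: k => [|k IH]; first by rewrite U_init.
  have xdom : edom f1 (x k) by apply: le_lt_trans IH _; rewrite ltry.
  have /andP[eta0 eta1] := eta01 k.
  have f1x := edom_fin_num (f1_ninfty (x k)) xdom.
  rewrite x_step UE.
  apply: le_trans (convex_efun_fin f1_convex _ f1x (f1yt k)) _.
    by rewrite ltW.
  by rewrite lee_fin lerD2l ler_wpM2l ?subr_ge0// -lee_fin -f1x.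
have xdom k : edom f1 (x k) by apply: le_lt_trans (f1x_le k) _; rewrite ltry.
have f1x k : f1 (x k) = (fine (f1 (x k)))%:E by exact: edom_fin_num.
have f1yh k : f1 (yh k) = (fine (f1 (yh k)))%:E.
  by apply: edom_fin_num => //; exact: prox_edom (xdom k) (yh_prox k).
pose D k := smooth_model f0 (alpha k) (x k) (yt k) + v k - U k.
have DU k :=
  inexact_minimizer (alpha0 k) mu0 (yh_prox k) (f1x k) (f1yt k) (f1yh k)
    (inexact k).
have D_le0 k : D k <= 0 by have [] := DU k.
have delta0 : 0 < delta by case/andP: delta01.
have omega0 : 0 < omega by case/andP: omega01.
have omega1 : omega < 1 by case/andP: omega01.
have small_step_accepted k t : 0 < t <= 1 -> L * t <= (alpha k)^-1 ->
    sufficient_decrease f0 f1 omega (alpha k) (x k) (U k) (yt k) t.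
  move=> /andP[t0 t1] Lt.
  apply: (sufficient_decrease_small_step (alpha0 k) t0 omega1 (f1yt k) (D_le0 k)
    _ Lt).
  apply: (@descent _ _ (edom f1)) => // s /andP[s0 s1]; rewrite scalerA.
  apply: le_lt_trans (convex_efun_fin f1_convex _ (f1x k) (f1yt k)) _.
    by rewrite mulr_ge0 ?(ltW t0)//= mulr_ile1// ltW.
  by rewrite ltry.
pose c := Num.min 1 (delta / ((`|L| + 1) * alpha_max)).
have c0 : 0 < c.
  rewrite lt_min ltr01/= divr_gt0// mulr_gt0// ?ltr_wpDl//.
  exact: lt_le_trans alpha_min_max.
have cm k : c <= delta ^+ m k.
  have /andP[_ a_le] := alpha_bounds k.
  have aM : 0 < alpha k <= alpha_max by rewrite alpha0.
  exact: (backtracking_step_ge delta01 aM (small_step_accepted k) (m_least k)).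
pose P k := f0 (x k) + U k.
have P_decr k : P k.+1 <= P k - omega * c * - D k.
  rewrite /P UE x_step.
  apply: le_trans (accepted_step_decrease (f1yt k) (m_accept k) (eta_def k)) _.
  rewrite -/(D k) mulrN opprK lerD2l.
  by rewrite -!mulrA ler_pM2l// ler_wnM2r.
have [M FM] := F_bounded.
have P_ge k : M <= P k.
  rewrite -lee_fin EFinD; apply: le_trans (FM (x k)) _.
  by rewrite /objective leeD2lE.
have cD_ge0 k : 0 <= omega * c * - D k.
  by rewrite mulr_ge0 ?oppr_ge0// ltW// mulr_gt0.
have [l Pl cD_lim] := cvg_to0_of_decrease P_ge cD_ge0 P_decr.
have xs_dom : closure (edom f1) xs.
  move=> B /xs_lim; apply; exists 0%N => // k _ /=; exact: xdom.
have [diff_xs grad_xs] := f0_diff _ (domS _ xs_dom).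
have [phi phioo xphi] := cluster_subsequence xs_lim.
pose e k := (1 + mu / 2) * D k.
have e0 : e @ \oo --> (0 : R).
  have -> : e = (fun k => (- (1 + mu / 2) / (omega * c)) * (omega * c * - D k)).
    by apply/funext => k; rewrite /e; field; rewrite !lt0r_neq0.
  rewrite -(mulr0 (- (1 + mu / 2) / (omega * c))).
  by apply: cvgM => //; exact: cvg_cst.
(* The proximal weight is weakened to alpha_min so that it does not depend
   on k. *)
have model_below k y : ((U k + e k - dotp (grad f0 (x k)) (y - x k)
    - (2 * alpha_min)^-1 * dotp (y - x k) (y - x k))%:E <= f1 y)%E.
  case f1y : (f1 y) => [r| |]; last 2 first.
  - by rewrite leey.
  - by have := f1_ninfty y; rewrite f1y.
  rewrite lee_fin.
  have [_ Uyh] := DU k.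
  have yh_min := prox_minimizes_model (alpha0 k) (yh_prox k) (f1yh k) f1y.
  have : (2 * alpha k)^-1 * dotp (y - x k) (y - x k)
      <= (2 * alpha_min)^-1 * dotp (y - x k) (y - x k).
    have /andP[am _] := alpha_bounds k.
    by rewrite ler_wpM2r ?dotp_ge0// lef_pV2 ?posrE ?mulr_gt0// ler_pM2l.
  have := le_trans Uyh yh_min.
  by rewrite -/(D k) -/(e k) {1}/smooth_model enorm_sqr; lra.
have [xs_stat ->] :=
  limit_of_models_stationary f1_lsc diff_xs grad_xs xphi
    (cvg_comp _ _ phioo Pl) (cvg_comp _ _ phioo e0)
    (fun j => f1x_le (phi j)) (fun j => model_below (phi j)).
by split=> //; apply: cvg_EFin; [exact: nearW|exact: Pl].
Qed.
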